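(* In the setting described in the context, the mapping $\psi: x\#b\mapsto xb\in M_2$ ($x\in M_1$, $b\in B$) defines an isomorphism between the smash product algebra $M_1\#B$ and the algebra $M_2$.
   Context: Conventions. $k$ is a field; algebras are unital associative $k$-algebras; summation over repeated indices (finite sums) is understood; $C_X(Y)$ is the centralizer of $Y$ in $X$; Sweedler notation $\Delta(h)=h_{(1)}\otimes h_{(2)}$ is used. Extensions. An algebra extension $M/N$ is Frobenius if there are an $N$-$N$-bimodule map $E:M\to N$ (Frobenius homomorphism) and finite families $\{x_i\},\{y_i\}$ in $M$ (dual bases for $E$) with $E(mx_i)y_i=m=x_iE(y_im)$ for all $m\in M$. It is strongly separable of index $\lambda^{-1}$ if also $E(1)=1$ and $x_iy_i=\lambda^{-1}1$ with $0\neq\lambda\in k$. It is a Markov extension if moreover there is a trace $T:N\to k$ (Markov trace) with $T(1)=1$ such that $T_0:=T\circ E$ is a trace on $M$. It is a symmetric Markov extension if moreover $E(ux)=E(xu)$ for all $x\in M$, $u\in U:=C_M(N)$. A $k$-algebra is Kanzaki separable if it has a separability element that is symmetric (invariant under the flip). Jones tower. $M_1=M\otimes_N M$, $e_1=1\otimes 1$, elements written $me_1m'=m\otimes m'$, product $(me_1m')(ne_1n')=mE(m'n)e_1n'$, unit $x_ie_1y_i$, $M\subset M_1$ via $m\mapsto mx_ie_1y_i$, and $E_M:M_1\to M$, $E_M(me_1m')=\lambda mm'$. $M_1/M$ is again a symmetric Markov extension of index $\lambda^{-1}$ with Frobenius homomorphism $E_M$ and Markov trace $T_0$. Iterating for $M_1/M$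 gives $M_2=M_1e_2M_1$ and $E_{M_1}:M_2\to M_1$, $E_{M_1}(xe_2y)=\lambda xy$. Put $T_1=T_0\circ E_M$, $T_2=T_1\circ E_{M_1}$ (traces on $M_1$, $M_2$). Centralizers: $U=C_M(N)$, $V=C_{M_1}(M)$, $W=C_{M_2}(M_1)$, $A=C_{M_1}(N)$, $B=C_{M_2}(M)$, $C=C_{M_2}(N)$. $T$ also denotes the restriction of $T_2$ to $C$. Let $\phi:U\to V$, $\phi(u)=x_iue_1y_i$ (an algebra anti-isomorphism). Standing assumptions. (i) $M/N$ is a symmetric Markov extension. (ii) Symmetric product: $x_iy_i=y_ix_i=\lambda^{-1}1$ (alternatively, instead of $y_ix_i=\lambda^{-1}1$ one may assume $T_0|_U=T_1\circ\phi$). (iii) Weak irreducibility: $U$ is a Kanzaki separable $k$-algebra and $T_0|_U$ is a non-degenerate trace. (iv) Depth $2$: $E_M$ has dual bases lying in $A$, and $E_{M_1}$ has dual bases $\{u_j\},\{v_j\}$ lying in $B$. Structure on $B$. $f=f^{(1)}\otimes f^{(2)}$ is the unique symmetric separability element of $V$ and $w=[f^{(1)}T(f^{(2)})]^{-1}\in Z(V)$ (an invertible element of the center of $V$). The bilinear forms $\langle a,b\rangle=\lambda^{-2}T(ae_2e_1wb)$ and $\langle a,b\rangle'=\lambda^{-2}T(be_1e_2wa)$ on $A\times B$ are non-degenerate. $B$ is a weak Hopf algebra with $\Delta(b)=b_{(1)}\otimes b_{(2)}$ defined by $\langle a_1,b_{(1)}\rangle\langle a_2,b_{(2)}\rangle=\langle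 a_1a_2,b\rangle$ for all $a_1,a_2\in A$; $\varepsilon(b)=\langle 1,b\rangle$; and antipode $S:B\to B$ defined by $\langle a,b\rangle=\langle a,S(b)\rangle'$ for all $a\in A$. $B$ acts on $M_1$ (making $M_1$ a left $B$-module algebra) by $b\triangleright x=\lambda^{-1}E_{M_1}(bxe_2)$. Smash product. For a weak Hopf algebra $H$ with target counital map $\varepsilon_t(h)=\varepsilon(1_{(1)}h)1_{(2)}$ and target counital subalgebra $H_t=\varepsilon_t(H)$, and a left $H$-module algebra $X$ (a left $H$-module with $h\cdot(xy)=(h_{(1)}\cdot x)(h_{(2)}\cdot y)$, $h\cdot1=\varepsilon_t(h)\cdot1$), the smash product $X\#H$ is the vector space $X\otimes_{H_t}H$, where $H$ is a left $H_t$-module by multiplication and $X$ is a right $H_t$-module by $x\cdot z=S^{-1}(z)\cdot x=x(z\cdot1)$; writing $x\#h$ for the class of $x\otimes h$, the product is $(x\#h)(y\#g)=x(h_{(1)}\cdot y)\#h_{(2)}g$ and the unit is $1\#1$. For $H=B$ one has $B_t=V$. *)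

(* Defs.v *)
From HB Require Import structures.
From mathcomp Require Import all_boot all_algebra generic_quotient.
From mathcomp Require Import boolp.

Set Implicit Arguments.
Unset Strict Implicit.
Unset Printing Implicit Defensive.

Import GRing.Theory.
Local Open Scope ring_scope.
Local Open Scope quotient_scope.

(* The balanced tensor product of X and Y, where R acts on X on the right by ra
   and on Y on the left by la: formal sums of pairs, modulo the smallest k-linear
   congruence making (x, y) bilinear and R-balanced. *)
Section Tensor.
Variables (k : fieldType) (X Y : lmodType k) (R : Type).
Variables (ra : X -> R -> X) (la : R -> Y -> Y).

Definition fscale (c : k) (s : seq (X * Y)) := [seq (c *: p.1, p.2) | p <- s].

Inductive teq : seq (X * Y) -> seq (X * Y) -> Prop :=
| teq_refl s : teq s s
| teq_sym s t : teq s t -> teq t s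
| teq_trans s t u : teq s t -> teq t u -> teq s u
| teq_cat s s' t t' : teq s s' -> teq t t' -> teq (s ++ t) (s' ++ t')
| teq_catC s t : teq (s ++ t) (t ++ s)
| teq_scale c s t : teq s t -> teq (fscale c s) (fscale c t)
| teq_0 y : teq [:: (0, y)] [::]
| teq_Dl x x' y : teq [:: (x + x', y)] [:: (x, y); (x', y)]
| teq_Dr x y y' : teq [:: (x, y + y')] [:: (x, y); (x, y')]
| teq_Z c x y : teq [:: (c *: x, y)] [:: (x, c *: y)]
| teq_bal x r y : teq [:: (ra x r, y)] [:: (x, la r y)].

Definition teqb (s t : seq (X * Y)) : bool := `[< teq s t >].

Fact teqb_refl : reflexive teqb.
Proof. by move=> s; apply/asboolP; apply: teq_refl. Qed.

Fact teqb_sym : symmetric teqb.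
Proof. by move=> s t; apply/asboolP/asboolP => /teq_sym. Qed.

Fact teqb_trans : transitive teqb.
Proof.
move=> t s u /asboolP st /asboolP tu; apply/asboolP.
exact: teq_trans st tu.
Qed.

Canonical teq_equiv := EquivRel teqb teqb_refl teqb_sym teqb_trans.

Definition tens := {eq_quot teq_equiv}.
HB.instance Definition _ := Choice.on tens.

Local Notation cls := (\pi_({eq_quot teq_equiv}) : seq (X * Y) -> tens).

Definition reps (t : tens) : seq (X * Y) := repr t.

Definition pure (x : X) (y : Y) : tens := cls [:: (x, y)].

Lemma cls_eq s t : teq s t -> cls s = cls t.
Proof. by move=> st; apply/eqP; rewrite eqmodE; apply/asboolP. Qed.

Lemma teq_reps s : teq (reps (cls s)) s.
Proof.
have /eqP := reprK (cls s).
by rewrite (eqmodE teq_equiv) => /asboolP.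
Qed.

Lemma repsK t : cls (reps t) = t.
Proof. exact: reprK. Qed.

Lemma tensW (P : tens -> Prop) : (forall s, P (cls s)) -> forall t, P t.
Proof. by move=> H t; rewrite -(repsK t). Qed.

Definition tzero : tens := cls [::].
Definition tadd (s t : tens) : tens := cls (reps s ++ reps t).
Definition tscale (c : k) (t : tens) : tens := cls (fscale c (reps t)).
Definition topp (t : tens) : tens := tscale (-1) t.

Lemma tadd_cls s t : tadd (cls s) (cls t) = cls (s ++ t).
Proof. by apply/cls_eq/teq_cat; apply: teq_reps. Qed.

Lemma tscale_cls c s : tscale c (cls s) = cls (fscale c s).
Proof. by apply/cls_eq/teq_scale/teq_reps. Qed.

Fact taddA : associative tadd.
Proof. by elim/tensW=> s; elim/tensW=> t; elim/tensW=> u; rewrite !tadd_cls catA. Qed.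

Fact taddC : commutative tadd.
Proof. by elim/tensW=> s; elim/tensW=> t; rewrite !tadd_cls; apply/cls_eq/teq_catC. Qed.

Fact tadd0 : left_id tzero tadd.
Proof. by elim/tensW=> s; rewrite tadd_cls. Qed.

Lemma fscale_cat c s t : fscale c (s ++ t) = fscale c s ++ fscale c t.
Proof. exact: map_cat. Qed.

Lemma tscaleDl_cls c d s : cls (fscale (c + d) s) = cls (fscale c s ++ fscale d s).
Proof.
elim: s => [|[x y] s IHs] //=.
rewrite -cat1s -tadd_cls IHs scalerDl.
rewrite (cls_eq (teq_Dl _ _ _)) tadd_cls /=.
rewrite -[_ :: _]/([:: (c *: x, y)] ++ ([:: (d *: x, y)] ++ (fscale c s ++ fscale d s))).
rewrite -[(_, _) :: (_ ++ _)]/([:: (c *: x, y)] ++ (fscale c s ++ ([:: (d *: x, y)] ++ fscale d s))).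
rewrite -!tadd_cls; congr (tadd _ _).
by rewrite !taddA; congr (tadd _ _); rewrite taddC.
Qed.

Lemma fscale0 s : cls (fscale 0 s) = tzero.
Proof.
elim: s => [|[x y] s IHs] //=.
by rewrite -cat1s -tadd_cls IHs scale0r (cls_eq (teq_0 _)) tadd0.
Qed.

Lemma fscale1 s : fscale 1 s = s.
Proof. by rewrite /fscale -[RHS]map_id; apply: eq_map => -[x y] /=; rewrite scale1r. Qed.

Fact taddN : left_inverse tzero topp tadd.
Proof.
elim/tensW=> s; rewrite /topp tscale_cls -[in X in tadd _ X](fscale1 s).
by rewrite tadd_cls -tscaleDl_cls addNr fscale0.
Qed.

HB.instance Definition _ := GRing.isZmodule.Build tens taddA taddC tadd0 taddN.

Fact tscaleA c d t : tscale c (tscale d t) = tscale (c * d) t.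
Proof.
elim/tensW: t => s; rewrite !tscale_cls /fscale -map_comp.
by congr (cls _); apply: eq_map => p /=; rewrite scalerA.
Qed.

Fact tscale1 : left_id 1 tscale.
Proof. by elim/tensW=> s; rewrite tscale_cls fscale1. Qed.

Fact tscaleDr : right_distributive tscale +%R.
Proof.
move=> c; elim/tensW=> s; elim/tensW=> t.
by rewrite [_ + _]tadd_cls !tscale_cls [_ + _]tadd_cls -fscale_cat.
Qed.

Fact tscaleDl t : {morph tscale^~ t : c d / c + d}.
Proof.
by move=> c d; elim/tensW: t => s; rewrite !tscale_cls tscaleDl_cls -tadd_cls.
Qed.

HB.instance Definition _ :=
  GRing.Zmodule_isLmodule.Build k tens tscaleA tscale1 tscaleDr tscaleDl.

Lemma pureDl x x' y : pure (x + x') y = pure x y + pure x' y.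
Proof. by rewrite [_ + pure _ _]tadd_cls; apply/cls_eq/teq_Dl. Qed.

Lemma pureDr x y y' : pure x (y + y') = pure x y + pure x y'.
Proof. by rewrite [_ + pure _ _]tadd_cls; apply/cls_eq/teq_Dr. Qed.

Lemma pureZl c x y : pure (c *: x) y = c *: pure x y.
Proof. by rewrite [c *: pure _ _]tscale_cls. Qed.

Lemma pureZr c x y : pure x (c *: y) = c *: pure x y.
Proof. by rewrite -pureZl; apply/esym/cls_eq/teq_Z. Qed.

Lemma pure_bal x r y : pure (ra x r) y = pure x (la r y).
Proof. exact/cls_eq/teq_bal. Qed.

Lemma pure_suml I (s : seq I) (f : I -> X) y :
  pure (\sum_(i <- s) f i) y = \sum_(i <- s) pure (f i) y.
Proof.
elim: s => [|i s IHs]; last by rewrite !big_cons pureDl IHs.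
by rewrite !big_nil -[0 in LHS](scale0r 0) pureZl scale0r.
Qed.

Lemma pure_sumr I (s : seq I) x (f : I -> Y) :
  pure x (\sum_(i <- s) f i) = \sum_(i <- s) pure x (f i).
Proof.
elim: s => [|i s IHs]; last by rewrite !big_cons pureDr IHs.
by rewrite !big_nil -[0 in LHS](scale0r 0) pureZr scale0r.
Qed.

Lemma clsE s : cls s = \sum_(p <- s) pure p.1 p.2.
Proof.
elim: s => [|[x y] s IHs]; first by rewrite big_nil.
by rewrite big_cons -cat1s -tadd_cls IHs.
Qed.

Lemma tensE t : t = \sum_(p <- reps t) pure p.1 p.2.
Proof. by rewrite -clsE repsK. Qed.

(* Sweedler-style evaluation of g on a representative of t; for a bilinear and
   balanced g it does not depend on the representative, and is the linear map
   induced by g. *)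
Definition tlift (Z : zmodType) (g : X -> Y -> Z) (t : tens) : Z :=
  \sum_(p <- reps t) g p.1 p.2.

Record balanced (Z : lmodType k) (g : X -> Y -> Z) : Prop := Balanced {
  balDl : forall x x' y, g (x + x') y = g x y + g x' y;
  balDr : forall x y y', g x (y + y') = g x y + g x y';
  balZl : forall c x y, g (c *: x) y = c *: g x y;
  balZr : forall c x y, g x (c *: y) = c *: g x y;
  balR : forall x r y, g (ra x r) y = g x (la r y) }.

Lemma tlift_cls (Z : lmodType k) (g : X -> Y -> Z) s :
  balanced g -> tlift g (cls s) = \sum_(p <- s) g p.1 p.2.
Proof.
case=> gDl gDr gZl gZr gR; rewrite /tlift; move: (teq_reps s).
move: (reps _) => r; elim=> {r s} [//|s t _ -> //|s t u _ -> _ -> //|||||||c x y|x r y].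
- by move=> s s' t t' _ IHs _ IHt; rewrite !big_cat IHs IHt.
- by move=> s t; rewrite !big_cat /= addrC.
- move=> c s t _ IH; rewrite !big_map /=.
  by under eq_bigr do rewrite gZl; rewrite -scaler_sumr IH scaler_sumr;
     apply: eq_bigr => p _; rewrite gZl.
- by move=> y; rewrite big_seq1 big_nil -[X in g X _](scale0r 0) gZl scale0r.
- by move=> x x' y; rewrite !big_cons !big_nil !addr0 gDl.
- by move=> x y y'; rewrite !big_cons !big_nil !addr0 gDr.
- by rewrite !big_seq1 /= gZl gZr.
- by rewrite !big_seq1 /= gR.
Qed.

Section Lift.
Variables (Z : lmodType k) (g : X -> Y -> Z) (balg : balanced g).

Lemma tlift_pure x y : tlift g (pure x y) = g x y.
Proof. by rewrite tlift_cls // big_seq1. Qed.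

Lemma tlift_lin : linear (tlift g).
Proof.
move=> c; elim/tensW=> s; elim/tensW=> t.
rewrite [c *: _]tscale_cls [_ + _]tadd_cls !tlift_cls // big_cat big_map /=.
by rewrite scaler_sumr; congr (_ + _); apply: eq_bigr => p _; rewrite (balZl balg).
Qed.
End Lift.

Lemma linear_ext (Z : lmodType k) (f f' : tens -> Z) : linear f -> linear f' ->
  (forall x y, f (pure x y) = f' (pure x y)) -> f =1 f'.
Proof.
move=> lf lf' ff' t; rewrite (tensE t); elim: (reps t) => [|p s IHs].
  have f0 (h : tens -> Z) : linear h -> h 0 = 0.
    by move=> lh; have := lh (-1) 0 0; rewrite scaler0 addr0 scaleN1r addNr.
  by rewrite big_nil !f0.
by rewrite big_cons -[pure _ _]scale1r lf lf' IHs ff'.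
Qed.

End Tensor.

Arguments pure {k X Y R ra la} x y.

(* The tensor product over the ground field. *)
Definition ktens (k : fieldType) (X Y : lmodType k) :=
  tens (fun (x : X) (c : k) => c *: x) (fun (c : k) (y : Y) => c *: y).

Section Centralizer.
Variables (k : fieldType) (X : algType k) (D : X -> Prop).

Definition centr : {pred X} := [pred x | `[< forall y, D y -> x * y = y * x >]].

Lemma centrP x : reflect (forall y, D y -> x * y = y * x) (x \in centr).
Proof. by rewrite inE; apply: asboolP. Qed.

Fact centr_subalg : subalg_closed centr.
Proof.
split.
- by apply/centrP => y _; rewrite mul1r mulr1.
- move=> c x x' /centrP Dx /centrP Dx'; apply/centrP => y Dy.
  by rewrite mulrDl mulrDr -scalerAl -scalerAr Dx // Dx'.
- move=> x x' /centrP Dx /centrP Dx'; apply/centrP => y Dy.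
  by rewrite -mulrA Dx' // mulrA Dx // mulrA.
Qed.

HB.instance Definition _ := GRing.isSubalgClosed.Build k X centr centr_subalg.

Definition centralizer := {x : X | x \in centr}.
HB.instance Definition _ := Choice.on centralizer.
HB.instance Definition _ := SubChoice.on centralizer.
HB.instance Definition _ := [SubChoice_isSubAlgebra of centralizer by <:].

End Centralizer.

Section Extensions.
Variable k : fieldType.

Definition dual_bases (N M : algType k) (i : N -> M) (E : M -> N)
    (s : seq (M * M)) : Prop :=
  (forall m, \sum_(p <- s) i (E (m * p.1)) * p.2 = m) /\
  (forall m, \sum_(p <- s) p.1 * i (E (p.2 * m)) = m).

(* Strongly separable extensions of index lam^-1.  The inclusion inc need not be
   assumed injective: E (inc n) = n * E 1 = n. *)
Record ssext (N M : algType k) := SSExt {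
  inc : {lrmorphism N -> M};
  frob : {linear M -> N};
  dual : seq (M * M);
  lam : k;
  frob_l : forall n m, frob (inc n * m) = n * frob m;
  frob_r : forall m n, frob (m * inc n) = frob m * n;
  dualP : dual_bases inc frob dual;
  lam_neq0 : lam != 0;
  frob1 : frob 1 = 1;
  dual_index : \sum_(p <- dual) p.1 * p.2 = lam^-1 *: 1 }.

End Extensions.

(* The basic construction M_1 = M (x)_N M. *)
Section Basic.
Variables (k : fieldType) (N M : algType k) (F : ssext N M).
Local Notation i := (inc F).
Local Notation E := (frob F).

Definition basic : Type :=
  tens (fun (m : M) (n : N) => m * i n) (fun (n : N) (m : M) => i n * m).
HB.instance Definition _ := GRing.Lmodule.on basic.

Definition bpure (m m' : M) : basic := pure m m'.

Definition bmul (s t : basic) : basic :=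
  tlift (fun m m' => tlift (fun n n' => bpure (m * i (E (m' * n))) n') t) s.

Definition bone : basic := \sum_(p <- dual F) bpure p.1 p.2.

Let bal2 m m' : balanced (fun (m : M) (n : N) => m * i n)
  (fun (n : N) (m : M) => i n * m) (fun n n' => bpure (m * i (E (m' * n))) n').
Proof.
split=> *; rewrite /bpure.
- by rewrite mulrDr !linearD /= mulrDr pureDl.
- by rewrite pureDr.
- by rewrite -scalerAr !linearZ /= -scalerAr pureZl.
- by rewrite pureZr.
- by rewrite mulrA frob_r rmorphM mulrA pure_bal.
Qed.

Let bal1 (t : basic) : balanced (fun (m : M) (n : N) => m * i n)
  (fun (n : N) (m : M) => i n * m)
  (fun m m' => tlift (fun n n' => bpure (m * i (E (m' * n))) n') t : basic).
Proof.
split=> *; rewrite /tlift /bpure.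
- by rewrite -big_split; apply: eq_bigr => p _; rewrite mulrDl pureDl.
- by rewrite -big_split; apply: eq_bigr => p _; rewrite mulrDl !linearD /= mulrDr pureDl.
- by rewrite scaler_sumr; apply: eq_bigr => p _; rewrite -scalerAl pureZl.
- by rewrite scaler_sumr; apply: eq_bigr => p _; rewrite -scalerAl !linearZ /= -scalerAr pureZl.
- by apply: eq_bigr => p _; rewrite -!mulrA frob_l rmorphM.
Qed.

Lemma bmul_linr s : linear (bmul s).
Proof.
move=> c t u; rewrite /bmul /tlift scaler_sumr -big_split.
by apply: eq_bigr => p _; apply: (tlift_lin (bal2 _ _)).
Qed.

Lemma bmul_linl t : linear (bmul^~ t).
Proof. exact: (tlift_lin (bal1 t)). Qed.

Lemma bmul_pure m m' n n' :
  bmul (bpure m m') (bpure n n') = bpure (m * i (E (m' * n))) n'.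
Proof. by rewrite /bmul (tlift_pure (bal1 _)) (tlift_pure (bal2 _ _)). Qed.

Lemma lin_comp (A B C : lmodType k) (f : B -> C) (g : A -> B) :
  linear f -> linear g -> linear (f \o g).
Proof. by move=> lf lg c x y; rewrite /= lg lf. Qed.

Lemma lin_sum (A B : lmodType k) I (s : seq I) (f : A -> B) (g : I -> A) :
  linear f -> f (\sum_(j <- s) g j) = \sum_(j <- s) f (g j).
Proof.
move=> lf; have f0 : f 0 = 0.
  by have := lf (-1) 0 0; rewrite scaler0 addr0 scaleN1r addNr.
elim: s => [|j s IHs]; first by rewrite !big_nil.
by rewrite !big_cons -[g j]scale1r lf IHs !scale1r.
Qed.

Fact bmulA : associative bmul.
Proof.
move=> s t u; move: u.
apply: linear_ext; [exact: lin_comp (bmul_linr _) (bmul_linr _)|exact: bmul_linr|].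
move=> e f; move: t; apply: linear_ext;
  [exact: lin_comp (bmul_linr _) (bmul_linl _)
  |exact: lin_comp (bmul_linl _) (bmul_linr _)|].
move=> c d; move: s; apply: linear_ext;
  [exact: bmul_linl|exact: lin_comp (bmul_linl _) (bmul_linl _)|].
move=> a b; rewrite -!/(bpure _ _) !bmul_pure.
by rewrite mulrA frob_r rmorphM mulrA.
Qed.

Fact bmul1l : left_id bone bmul.
Proof.
apply: linear_ext => [|//|a b]; first exact: bmul_linr.
rewrite -/(bpure a b) /bone (lin_sum _ _ (@bmul_linl _)).
under eq_bigr do rewrite bmul_pure.
by rewrite /bpure -pure_suml (dualP F).2.
Qed.

Fact bmul1r : right_id bone bmul.
Proof.
apply: linear_ext => [|//|a b]; first exact: bmul_linl.
rewrite -/(bpure a b) /bone (lin_sum _ _ (bmul_linr _)).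
under eq_bigr do rewrite bmul_pure /bpure pure_bal.
by rewrite /bpure -pure_sumr (dualP F).1.
Qed.

Fact bmulDl : left_distributive bmul +%R.
Proof. by move=> s t u; have := bmul_linl u 1 s t; rewrite !scale1r. Qed.

Fact bmulDr : right_distributive bmul +%R.
Proof. by move=> s t u; have := bmul_linr s 1 t u; rewrite !scale1r. Qed.

Definition bfrob (t : basic) : M := tlift (fun m m' => lam F *: (m * m')) t.

Let balE : balanced (fun (m : M) (n : N) => m * i n)
  (fun (n : N) (m : M) => i n * m) (fun m m' => lam F *: (m * m')).
Proof.
split=> *.
- by rewrite mulrDl scalerDr.
- by rewrite mulrDr scalerDr.
- by rewrite -scalerAl !scalerA mulrC.
- by rewrite -scalerAr !scalerA mulrC.
- by rewrite mulrA.
Qed.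

Fact bfrob_lin : linear bfrob.
Proof. exact: (tlift_lin balE). Qed.
HB.instance Definition _ := GRing.isLinear.Build k basic M *:%R bfrob bfrob_lin.

Lemma bfrob_pure m m' : bfrob (bpure m m') = lam F *: (m * m').
Proof. exact: (tlift_pure balE). Qed.

Lemma bfrob_one : bfrob bone = 1.
Proof.
rewrite /bone linear_sum /=; under eq_bigr do rewrite bfrob_pure.
by rewrite -scaler_sumr dual_index scalerA mulfV ?scale1r ?lam_neq0.
Qed.

Fact bone_neq0 : bone != 0.
Proof.
apply/eqP => b0; have := bfrob_one; rewrite b0 linear0 => /esym/eqP.
by rewrite oner_eq0.
Qed.

HB.instance Definition _ := GRing.Zmodule_isNzRing.Build basic
  bmulA bmul1l bmul1r bmulDl bmulDr bone_neq0.

Fact bscaleAl (c : k) (s t : basic) : c *: (s * t) = (c *: s) * t.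
Proof.
have b0 : bmul 0 t = 0.
  by have := bmul_linl t (-1) 0 0; rewrite scaler0 addr0 scaleN1r addNr.
by have := bmul_linl t c s 0; rewrite b0 !addr0 => <-.
Qed.

HB.instance Definition _ := GRing.Lmodule_isLalgebra.Build k basic bscaleAl.

Fact bscaleAr (c : k) (s t : basic) : c *: (s * t) = s * (c *: t).
Proof.
have b0 : bmul s 0 = 0.
  by have := bmul_linr s (-1) 0 0; rewrite scaler0 addr0 scaleN1r addNr.
by have := bmul_linr s c t 0; rewrite b0 !addr0 => <-.
Qed.

HB.instance Definition _ := GRing.Lalgebra_isAlgebra.Build k basic bscaleAr.

Definition binc (m : M) : basic := \sum_(p <- dual F) bpure (m * p.1) p.2.

Fact binc_lin : linear binc.
Proof.
move=> c m m'; rewrite /binc scaler_sumr -big_split; apply: eq_bigr => p _.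
by rewrite mulrDl -scalerAl /bpure pureDl pureZl.
Qed.
HB.instance Definition _ := GRing.isLinear.Build k M basic *:%R binc binc_lin.

Lemma binc_mull m a b : binc m * bpure a b = bpure (m * a) b.
Proof.
rewrite /binc mulr_suml.
under eq_bigr do rewrite [_ * _]bmul_pure -mulrA.
by rewrite /bpure -pure_suml -mulr_sumr (dualP F).2.
Qed.

Lemma binc_mulr m a b : bpure a b * binc m = bpure a (b * m).
Proof.
rewrite /binc mulr_sumr.
under eq_bigr do rewrite [_ * _]bmul_pure mulrA /bpure pure_bal.
by rewrite -pure_sumr (dualP F).1.
Qed.

Fact binc_monoid : monoid_morphism binc.
Proof.
split; first by rewrite /binc; apply: eq_bigr => p _; rewrite mul1r.
move=> m m'; rewrite [binc m' in RHS]/binc mulr_sumr.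
by apply: eq_bigr => p _; rewrite binc_mull mulrA.
Qed.
HB.instance Definition _ := GRing.isMonoidMorphism.Build M basic binc binc_monoid.

Let ind (P : basic -> Prop) : P 0 -> (forall s t, P s -> P t -> P (s + t)) ->
  (forall a b, P (bpure a b)) -> forall t, P t.
Proof.
move=> P0 PD Pp t; rewrite [t]tensE; elim: (reps _) => [|p s IHs].
  by rewrite big_nil.
by rewrite big_cons; apply: PD.
Qed.

Fact bfrob_l (m : M) (t : basic) : bfrob (binc m * t) = m * bfrob t.
Proof.
elim/ind: t => [|s t IHs IHt|a b].
- by rewrite mulr0 linear0 mulr0.
- by rewrite mulrDr !linearD /= IHs IHt mulrDr.
- by rewrite binc_mull !bfrob_pure -scalerAr mulrA.
Qed.

Fact bfrob_r (t : basic) (m : M) : bfrob (t * binc m) = bfrob t * m.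
Proof.
elim/ind: t => [|s t IHs IHt|a b].
- by rewrite mul0r linear0 mul0r.
- by rewrite mulrDl !linearD /= IHs IHt mulrDl.
- by rewrite binc_mulr !bfrob_pure -scalerAl mulrA.
Qed.

Definition bdual : seq (basic * basic) :=
  [seq ((lam F)^-1 *: bpure p.1 1, bpure 1 p.2) | p <- dual F].

Fact bdualP : dual_bases binc bfrob bdual.
Proof.
split=> t; rewrite /bdual big_map /=.
- elim/ind: t => [|s t IHs IHt|a b].
  + by rewrite big1 // => p _; rewrite mul0r !linear0 mul0r.
  + rewrite -[in RHS]IHs -[in RHS]IHt -big_split; apply: eq_bigr => p _ /=.
    by rewrite mulrDl !linearD /= mulrDl.
  + under eq_bigr => p _ do rewrite -scalerAr linearZ /= [_ * bpure p.1 1]bmul_pure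
      bfrob_pure scalerA mulVf ?lam_neq0 // scale1r mulr1 binc_mull mulr1 /bpure pure_bal.
    by rewrite -pure_sumr (dualP F).1.
- elim/ind: t => [|s t IHs IHt|a b].
  + by rewrite big1 // => p _; rewrite mulr0 !linear0 mulr0.
  + rewrite -[in RHS]IHs -[in RHS]IHt -big_split; apply: eq_bigr => p _ /=.
    by rewrite mulrDr !linearD /= mulrDr.
  + under eq_bigr => p _ do rewrite [bpure 1 p.2 * _]bmul_pure mul1r bfrob_pure
      linearZ /= -scalerAr -scalerAl scalerA mulfV ?lam_neq0 // scale1r
      binc_mulr mul1r /bpure -pure_bal.
    by rewrite -pure_suml (dualP F).2.
Qed.

Fact bdual_index : \sum_(p <- bdual) p.1 * p.2 = (lam F)^-1 *: 1.
Proof.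
rewrite /bdual big_map /= -[1 in RHS]/bone /bone scaler_sumr.
apply: eq_bigr => p _.
by rewrite -scalerAl [_ * _]bmul_pure mulr1 frob1 rmorph1 mulr1.
Qed.

(* The extension M_1/M with E_M(m (x) m') = lam m m'. *)
Definition basic_ext : ssext M basic :=
  @SSExt k M basic binc bfrob bdual (lam F) bfrob_l bfrob_r bdualP
    (lam_neq0 F) bfrob_one bdual_index.

Definition jones_e : basic := bpure 1 1.

End Basic.

Section Separability.
Variables (k : fieldType) (R : algType k).

Definition sym_sep_elt (f : ktens R R) : Prop :=
  [/\ tlift (fun x y => x * y) f = 1,
      forall r, tlift (fun x y => pure (r * x) y : ktens R R) f
              = tlift (fun x y => pure x (y * r) : ktens R R) f
    & tlift (fun x y => pure y x : ktens R R) f = f].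

Definition kanzaki_separable : Prop := exists f, sym_sep_elt f.

Definition is_trace (t : R -> k) : Prop := forall x y, t (x * y) = t (y * x).

End Separability.

(* The space X (x)_{H_t} H, with right action x . z = x (z . 1), and its smash
   product.  Delta, eps, S and act are raw data: the axioms of a weak Hopf algebra
   and of a module algebra matter only through is_smash_product, which includes
   that the product is well defined, associative and unital, and that the right
   action is also x . z = S^-1(z) . x. *)
Section Smash.
Variables (k : fieldType) (H X : algType k).
Variables (Delta : H -> ktens H H) (eps : H -> k) (S : H -> H).
Variable act : H -> X -> X.

Definition eps_t (h : H) : H :=
  tlift (fun h1 h2 => eps (h1 * h) *: h2) (Delta 1).

Definition target := {z : H | exists h, z = eps_t h}.

Definition smash :=
  tens (fun (x : X) (z : target) => x * act (sval z) 1)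
       (fun (z : target) (h : H) => sval z * h).

Definition spure (x : X) (h : H) : smash := pure x h.

Record is_smash_product (mul : smash -> smash -> smash) : Prop := {
  smash_antipode : bijective S;
  smash_right : forall y (z : target) x, S y = sval z ->
    act y x = x * act (sval z) 1;
  smash_linl : forall t, linear (mul^~ t);
  smash_linr : forall s, linear (mul s);
  smash_mulE : forall x h y g, mul (spure x h) (spure y g) =
    tlift (fun h1 h2 => spure (x * act h1 y) (h2 * g)) (Delta h);
  smash_assoc : associative mul;
  smash_1l : left_id (spure 1 1) mul;
  smash_1r : right_id (spure 1 1) mul }.

End Smash.

Definition image_of (X Y : Type) (i : X -> Y) (y : Y) : Prop := exists x, i x = y.

Section Tower.
Variables (k : fieldType) (N M : algType k) (F : ssext N M) (T : {scalar N}).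

Definition markov : Prop :=
  [/\ is_trace T, T 1 = 1 & is_trace (fun m => T (frob F m))].

Definition sym_markov : Prop :=
  markov /\ forall u x, u \in centr (image_of (inc F)) ->
    frob F (u * x) = frob F (x * u).

Definition M1 : algType k := basic F.
Definition F1 : ssext M M1 := basic_ext F.
Definition M2 : algType k := basic F1.
Definition F2 : ssext M1 M2 := basic_ext F1.

Definition T0 (x : M) : k := T (frob F x).
Definition T1 (x : M1) : k := T0 (frob F1 x).
Definition T2 (x : M2) : k := T1 (frob F2 x).

Definition j : M1 -> M2 := inc F2.
Definition e1 : M1 := jones_e F.
Definition e2 : M2 := jones_e F1.

Definition U : algType k := centralizer (image_of (inc F)).
Definition V : algType k := centralizer (image_of (inc F1)).
Definition A : algType k := centralizer (image_of (inc F1 \o inc F)).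
Definition B : algType k := centralizer (image_of (inc F2 \o inc F1)).

Definition phi (u : U) : M1 :=
  \sum_(p <- dual F) bpure F (p.1 * val u) p.2.

Definition symmetric_product : Prop :=
  \sum_(p <- dual F) p.2 * p.1 = (lam F)^-1 *: 1.

Definition weakly_irreducible : Prop :=
  kanzaki_separable U /\
  forall u : U, (forall u' : U, T0 (val u * val u') = 0) -> u = 0.

Definition depth2 : Prop :=
  (exists s : seq (A * A),
     dual_bases (inc F1) (frob F1) [seq (val p.1, val p.2) | p <- s]) /\
  (exists s : seq (B * B),
     dual_bases (inc F2) (frob F2) [seq (val p.1, val p.2) | p <- s]).

(* f^(1) T(f^(2)) *)
Definition sep_trace (f : ktens V V) : V :=
  tlift (fun v v' => T2 (j (val v')) *: v) f.

Section Forms.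
Variable w : V.

Definition form (a : A) (b : B) : k :=
  (lam F) ^- 2 * T2 (j (val a) * e2 * j e1 * j (val w) * val b).

Definition form' (a : A) (b : B) : k :=
  (lam F) ^- 2 * T2 (val b * j e1 * e2 * j (val w) * j (val a)).

Definition is_comult (Delta : B -> ktens B B) : Prop := forall a1 a2 b,
  tlift (fun b1 b2 => form a1 b1 * form a2 b2) (Delta b) = form (a1 * a2) b.

Definition counit (b : B) : k := form 1 b.

Definition is_antipode (S : B -> B) : Prop := forall a b,
  form a b = form' a (S b).
End Forms.

Definition action (b : B) (x : M1) : M1 :=
  (lam F)^-1 *: frob F2 (val b * j x * e2).

End Tower.

(* Main.v *)
Require Import Defs.
From HB Require Import structures.
From mathcomp Require Import all_boot all_algebra.
Import GRing.Theory.
Local Open Scope ring_scope.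

Set Implicit Arguments.
Unset Strict Implicit.
Unset Printing Implicit Defensive.

(** The idea of the proof.  Write lam for the inverse of the index, i(m) and j(x) for
    the inclusions of M and M_1 (usually suppressed), E, E_M, E_{M_1} for the
    Frobenius maps, and avg(c) = sum x_i c y_i for the average of c over the
    dual bases of M/N.  Since sum x_i (x) y_i is a Casimir element, avg(c)
    commutes with M as soon as c commutes with N.

    The map psi(x # b) = x b has an obvious candidate for an inverse,
    y |-> sum E_{M_1}(y u_j) # v_j, because the dual bases u_j, v_j of
    E_{M_1} lie in B.  It is a two-sided inverse if B_t = V, for then
    the elements E_{M_1}(b u_j) of V can be moved across the tensor sign.  The
    product of the smash product is the one transported from M_2, so that
    associativity and units are free, and it remains to prove three facts.

    (1) eps_t(h) = h |> 1 (eps_tE), hence B_t = V.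
    (2) b y = (b_1 |> y) b_2 for y in M_1 (smash_relation), which is the
        multiplication rule of the smash product.
    (3) S is bijective (antipode_bij), and S(y) = z in V implies y |> x = x z
        (act_antipode).

    All three follow from explicit formulas.  The map
    riesz(b) = E_{M_1}(e_2 e_1 w b) from B to A represents the pairing:
    <a, b> = lam^-2 T_1(a riesz(b)).  The relations
    e_2 y = lam^-1 e_2 E_{M_1}(e_2 y), e_1 e_2 e_1 = lam e_1 and avg(e_1) = 1 show that
    it is bijective, with inverse riesz_inv(a) = lam^-2 w^-1 avg(e_1 e_2 a).  A
    similar injective map riesz' represents the second pairing, and S is bijective
    because riesz = riesz' o S.

    As T_1 is non-degenerate on A, duality with the product of A becomes
    <a, b_1> b_2 = riesz_inv(riesz(b) a) (comult_left).  Taking b = 1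
    gives (1).  For (2), both sides are compatible with multiplication by M and
    M_1 = M e_1 M, so that y = e_1 is enough; expanding b_1 in a pair p, q of
    T_1-dual bases of A turns the right-hand side into
    lam^-2 w^-1 sum x_i e_1 e_2 riesz(b) D(y_i e_1) with D(x) = sum p u E_M(q x),
    where u in U corresponds to w^-1 in V.  The symmetric separability element of V
    provides dual bases for which D is the identity (dual_twist), and
    what is left is riesz_inv(riesz(b)) e_1 = b e_1.  For (3) the value of
    riesz_inv(a) |> e_1 (act_riesz_inv) is computed at a = riesz'(z) = lam z e_1 w. *)

(** * Averages over dual bases *)

Section Average.
Variables (k : fieldType) (N M : algType k) (F : ssext N M).
Variables (R : algType k) (h : {lrmorphism M -> R}).

Definition avg (c : R) : R := \sum_(p <- dual F) h p.1 * c * h p.2.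

(** The tensor sum x_i (x) y_i over N is a Casimir element: expanding m x_i in
    the dual bases produces coefficients in N, which pass through c and
    recombine on the other side. *)
Lemma avg_comm c m : (forall n, c * h (inc F n) = h (inc F n) * c) ->
  h m * avg c = avg c * h m.
Proof.
move=> cN; rewrite /avg mulr_sumr mulr_suml.
under eq_bigr => p _.
  rewrite !mulrA -rmorphM -[m * p.1](dualP F).2 rmorph_sum /= !mulr_suml.
  under eq_bigr => q _ do
    rewrite rmorphM /= -[_ * _ * c]mulrA -cN mulrA -[_ * h _ * h _]mulrA -rmorphM.
  over.
rewrite exchange_big /=; apply: eq_bigr => q _.
rewrite -mulr_sumr -rmorph_sum /=.
under eq_bigr => p _ do rewrite mulrA.
by rewrite (dualP F).1 rmorphM mulrA.
Qed.

Lemma avgM c x : (forall m, x * h m = h m * x) -> avg (c * x) = avg c * x.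
Proof.
by move=> xM; rewrite /avg mulr_suml; apply: eq_bigr => p _; rewrite -!mulrA xM.
Qed.

Lemma avgMl x c : (forall m, x * h m = h m * x) -> avg (x * c) = x * avg c.
Proof.
by move=> xM; rewrite /avg mulr_sumr; apply: eq_bigr => p _; rewrite !mulrA xM.
Qed.

Fact avg_lin : linear avg.
Proof.
move=> c x y; rewrite /avg scaler_sumr -big_split; apply: eq_bigr => p _ /=.
by rewrite mulrDr mulrDl -scalerAr -scalerAl.
Qed.
HB.instance Definition _ := GRing.isLinear.Build k R R *:%R avg avg_lin.

End Average.

(** * One step of the Jones tower *)

Lemma frobK (k : fieldType) (N M : algType k) (F : ssext N M) (n : N) :
  frob F (inc F n) = n.
Proof. by rewrite -[inc F n]mulr1 frob_l frob1 mulr1. Qed.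

Section JonesStep.
Variables (k : fieldType) (N M R : algType k) (F : ssext N M).

(** The relations between M, its basic construction R and the Jones idempotent e
    that all the computations rest upon.  Working with them instead of the
    concrete tensor product keeps the multiplication of R abstract; step_ind says
    that R = M e M. *)
Record jones_step (G : ssext M R) (e : R) : Prop := JonesStep {
  step_ind : forall P : R -> Prop, P 0 -> (forall s t, P s -> P t -> P (s + t)) ->
    (forall a b, P (inc G a * e * inc G b)) -> forall t, P t;
  step_comm : forall n, e * inc G (inc F n) = inc G (inc F n) * e;
  step_cut : forall x, e * inc G x * e = inc G (inc F (frob F x)) * e;
  step_avg : avg F (inc G) e = 1;
  step_frob : forall a b, frob G (inc G a * e * inc G b) = lam F *: (a * b) }.

Variables (G : ssext M R) (e : R) (st : jones_step G e).
Local Notation i := (inc F).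
Local Notation E := (frob F).
Local Notation la := (lam F).
Local Notation i1 := (inc G).
Local Notation E1 := (frob G).

Lemma frob1_e : E1 e = la *: 1.
Proof. by have := (step_frob st) 1 1; rewrite rmorph1 mulr1 mul1r mulr1. Qed.

Lemma frob1_eM a : E1 (i1 a * e) = la *: a.
Proof. by have := (step_frob st) a 1; rewrite rmorph1 !mulr1. Qed.

Lemma frob1_eMr a : E1 (e * i1 a) = la *: a.
Proof. by have := (step_frob st) 1 a; rewrite rmorph1 !mul1r. Qed.

(** The Pimsner-Popa identity: R e = M e, and E_M recovers the coefficient. *)
Lemma push_right y : y * e = i1 (la^-1 *: E1 (y * e)) * e.
Proof.
elim/(step_ind st): y => [|s t IHs IHt|a b].
- by rewrite !(mul0r, linear0).
- by rewrite mulrDl !linearD /= !mulrDl -IHs -IHt.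
have -> : i1 a * e * i1 b * e = i1 (a * i (E b)) * e.
  by rewrite -!mulrA [e * _]mulrA (step_cut st) !rmorphM !mulrA.
by rewrite frob1_eM scalerA mulVf ?lam_neq0 // scale1r.
Qed.

Lemma push_left y : e * y = e * i1 (la^-1 *: E1 (e * y)).
Proof.
elim/(step_ind st): y => [|s t IHs IHt|a b].
- by rewrite !(mulr0, linear0).
- by rewrite mulrDr !linearD /= !mulrDr -IHs -IHt.
have -> : e * (i1 a * e * i1 b) = e * i1 (i (E a) * b).
  by rewrite !mulrA (step_cut st) -(step_comm st) rmorphM !mulrA.
by rewrite frob1_eMr scalerA mulVf ?lam_neq0 // scale1r.
Qed.

(** On a e b and c e d both orders of multiplication reduce to
    lam t(E(b c) E(d a)), by the trace property of t and of t o E. *)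
Lemma trace_up (t : N -> k) : is_trace t -> {morph t : x y / x + y} -> t 0 = 0 ->
  (forall c x, t (c *: x) = c * t x) ->
  is_trace (t \o E) -> is_trace (t \o E \o E1).
Proof.
move=> tr tD t0 tZ trE x y /=.
elim/(step_ind st): x => [|s s' IHs IHs'|a b].
- by rewrite mul0r mulr0.
- by rewrite mulrDl mulrDr !linearD /= !tD IHs IHs'.
elim/(step_ind st): y => [|s s' IHs IHs'|c d].
- by rewrite mul0r mulr0.
- by rewrite mulrDl mulrDr !linearD /= !tD IHs IHs'.
have H a0 b0 c0 d0 : i1 a0 * e * i1 b0 * (i1 c0 * e * i1 d0)
    = i1 (a0 * i (E (b0 * c0))) * e * i1 d0.
  rewrite !mulrA -[_ * i1 b0 * _]mulrA -rmorphM /= -!mulrA [e * (_ * (e * _))]mulrA.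
  by rewrite [e * _ * (_ * _)]mulrA (step_cut st) !rmorphM !mulrA.
rewrite !H !(step_frob st) !linearZ /= !tZ; congr (_ * _).
have trE' u v : t (E (u * v)) = t (E (v * u)) := trE u v.
by rewrite trE' mulrA frob_r [RHS]trE' mulrA frob_r tr.
Qed.

End JonesStep.

Section Basic.
Variables (k : fieldType) (N M : algType k) (F : ssext N M).
Local Notation i := (inc F).
Local Notation E := (frob F).
Local Notation la := (lam F).
Local Notation i1 := (inc (basic_ext F)).
Local Notation E1 := (frob (basic_ext F)).
Local Notation e := (jones_e F).

Lemma bpure_bal a n b : bpure F (a * i n) b = bpure F a (i n * b).
Proof. exact: pure_bal. Qed.

Lemma bpureZ c a b : bpure F (c *: a) b = c *: bpure F a b.
Proof. exact: pureZl. Qed.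

Lemma bpureE a b : bpure F a b = i1 a * e * i1 b.
Proof. by rewrite [i1 a * _]binc_mull [_ * i1 b]binc_mulr mulr1 mul1r. Qed.

Lemma basic_ind (P : basic F -> Prop) : P 0 -> (forall s t, P s -> P t -> P (s + t)) ->
  (forall a b, P (i1 a * e * i1 b)) -> forall t, P t.
Proof.
move=> P0 PD Pp t; rewrite [t]tensE; elim: (reps _) => [|p s IHs].
  by rewrite big_nil.
by rewrite big_cons; apply: PD => //; rewrite -[pure _ _]/(bpure F _ _) bpureE.
Qed.

Lemma jones_comm n : e * i1 (i n) = i1 (i n) * e.
Proof.
rewrite [LHS]binc_mulr [RHS]binc_mull mulr1 mul1r -[X in bpure F 1 X]mulr1.
by rewrite -bpure_bal mul1r.
Qed.

Lemma jones_cut x : e * i1 x * e = i1 (i (E x)) * e.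
Proof.
rewrite [e * _]binc_mulr [LHS]bmul_pure [RHS]binc_mull !mul1r !mulr1.
reflexivity.
Qed.

Lemma avg_jones : avg F i1 e = 1.
Proof. by rewrite -[RHS]/(bone F) /bone; apply: eq_bigr => p _; rewrite bpureE. Qed.

Lemma frob1_jones a b : E1 (i1 a * e * i1 b) = la *: (a * b).
Proof. by rewrite -bpureE; apply: bfrob_pure. Qed.

Lemma basic_jones_step : jones_step F (basic_ext F) e.
Proof.
split; [exact: basic_ind|exact: jones_comm|exact: jones_cut|exact: avg_jones|].
exact: frob1_jones.
Qed.

End Basic.

Section Temperley.
Variables (k : fieldType) (N M : algType k) (F : ssext N M).
Local Notation i1 := (inc (basic_ext F)).
Local Notation j := (inc (basic_ext (basic_ext F))).
Local Notation e1 := (jones_e F).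
Local Notation e2 := (jones_e (basic_ext F)).

(** In M_1 (x)_M M_1 the left-hand side is the pure tensor e_1 (x) e_1, while j e_1 is
    a sum over the dual bases of M_1/M; the relation e_1 x e_1 = E(x) e_1 moves
    E(x_i) across the tensor sign, where the sum collapses. *)
Lemma temperley_lieb1 : j e1 * e2 * j e1 = lam F *: j e1.
Proof.
have -> : lam F *: j e1 = \sum_(p <- dual F) lam F *:
    bpure (basic_ext F) (e1 * ((lam F)^-1 *: bpure F p.1 1)) (bpure F 1 p.2).
  rewrite -scaler_sumr; congr (_ *: _).
  exact: (big_map _ _ (fun p => bpure (basic_ext F) (e1 * p.1) p.2)).
under [RHS]eq_bigr => p _.
  rewrite [bpure F p.1 1]bpureE rmorph1 mulr1 -scalerAr mulrA jones_cut -jones_comm.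
  rewrite bpureZ scalerA mulfV ?lam_neq0 // scale1r.
  rewrite (bpure_bal (basic_ext F)) [bpure F 1 _]bpureE rmorph1 mul1r.
  rewrite mulrA -jones_comm -mulrA -rmorphM /=.
  over.
rewrite /bpure -pure_sumr -mulr_sumr -rmorph_sum /=.
under eq_bigr => p _ do rewrite -[p.1]mul1r.
by rewrite (dualP F).1 rmorph1 mulr1 -bpureE.
Qed.
End Temperley.

(** * The centralizers U, V and A in a two-step tower *)

Section Tower.
Variables (k : fieldType) (N M R1 R2 : algType k).
Variables (F : ssext N M) (G : ssext M R1) (H : ssext R1 R2).
Variables (e1 : R1) (e2 : R2) (T : {scalar N}).
Local Notation la := (lam F).
Local Notation i := (inc F).
Local Notation E := (frob F).
Local Notation i1 := (inc G).
Local Notation E1 := (frob G).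
Local Notation j := (inc H).
Local Notation E2 := (frob H).
Hypothesis (st1 : jones_step F G e1) (st2 : jones_step G H e2).
(* The index does not change along the tower. *)
Hypothesis lamG : lam G = la.
Hypothesis e1e2e1 : j e1 * e2 * j e1 = la *: j e1.
Local Notation t0 x := (T (E x)).
Local Notation t1 x := (T (E (E1 x))).
Local Notation t2 x := (T (E (E1 (E2 x)))).

Definition inU (u : M) := forall n, u * i n = i n * u.
Definition inA (a : R1) := forall n, a * i1 (i n) = i1 (i n) * a.
Definition inV (v : R1) := forall m, v * i1 m = i1 m * v.
Definition inB (b : R2) := forall m, b * j (i1 m) = j (i1 m) * b.

Hypothesis trT : forall x y, T (x * y) = T (y * x).
Hypothesis trT0 : forall x y, t0 (x * y) = t0 (y * x).
Hypothesis symE : forall u x, inU u -> E (u * x) = E (x * u).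
(* The part of the symmetric product condition that enters the proof: it is a
   consequence of either of its two alternatives. *)
Hypothesis flip_dual : forall u, inU u ->
  la * t0 ((\sum_(p <- dual F) p.2 * p.1) * u) = t0 u.

Lemma la_unit : la != 0.
Proof. exact: lam_neq0. Qed.
Hint Resolve la_unit : core.

Lemma trT1 x y : t1 (x * y) = t1 (y * x).
Proof.
apply: (@trace_up _ _ _ _ F _ _ st1 T) => //; first exact: raddfD.
- exact: raddf0.
- by move=> c z; rewrite linearZ.
Qed.

Lemma trT2 x y : t2 (x * y) = t2 (y * x).
Proof.
apply: (@trace_up _ _ _ _ G _ _ st2 (fun x => t0 x)) => //.
- by move=> ? ?; rewrite !linearD.
- by rewrite !linear0.
- by move=> c z; rewrite !linearZ.
- exact: trT1.
Qed.

Lemma inV_A v : inV v -> inA v.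
Proof. by move=> vV n. Qed.

Lemma inA_i1 u : inU u -> inA (i1 u).
Proof. by move=> uU n; rewrite -!rmorphM uU. Qed.

Lemma inA_e1 : inA e1.
Proof. exact: (step_comm st1). Qed.

Lemma inAM x y : inA x -> inA y -> inA (x * y).
Proof. by move=> xA yA n; rewrite -mulrA yA mulrA xA mulrA. Qed.

Lemma inVM x y : inV x -> inV y -> inV (x * y).
Proof. by move=> xA yA n; rewrite -mulrA yA mulrA xA mulrA. Qed.

Lemma inB_j v : inV v -> inB (j v).
Proof. by move=> vV m; rewrite -!rmorphM vV. Qed.

Lemma inB_e2 : inB e2.
Proof. exact: (step_comm st2). Qed.

Lemma inBM x y : inB x -> inB y -> inB (x * y).
Proof. by move=> xA yA n; rewrite -mulrA yA mulrA xA mulrA. Qed.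

Lemma E1_A x : inA x -> inU (E1 x).
Proof. by move=> xA n; rewrite -[LHS]frob_r xA frob_l. Qed.

Lemma E2_B x : inB x -> inV (E2 x).
Proof. by move=> xA n; rewrite -[LHS]frob_r xA frob_l. Qed.

(** The inverse of the anti-isomorphism phi from U to V, extended to all of M_1.
    It is characterised by v e_1 = u e_1. *)
Definition phi_inv (v : R1) : M := la^-1 *: E1 (v * e1).

Fact phi_inv_lin : linear phi_inv.
Proof.
by move=> c x y; rewrite /phi_inv mulrDl -scalerAl linearP /= scalerDr !scalerA mulrC.
Qed.
HB.instance Definition _ := GRing.isLinear.Build k R1 M *:%R phi_inv phi_inv_lin.

Lemma phi_invE v : v * e1 = i1 (phi_inv v) * e1.
Proof. exact: (push_right st1). Qed.

Lemma phi_inv_unique v u : v * e1 = i1 u * e1 -> phi_inv v = u.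
Proof. by rewrite /phi_inv => ->; rewrite (frob1_eM st1) scalerA mulVf ?scale1r. Qed.

Lemma phi_inv_U v : inV v -> inU (phi_inv v).
Proof.
move=> vV n; rewrite /phi_inv -scalerAl -scalerAr.
by rewrite (E1_A (inAM (inV_A vV) inA_e1)).
Qed.

Lemma phi_inv1 : phi_inv 1 = 1.
Proof. by apply: phi_inv_unique; rewrite rmorph1. Qed.

Lemma phi_inv_anti v v' : inV v -> inV v' -> phi_inv (v * v') = phi_inv v' * phi_inv v.
Proof.
move=> vV v'V; apply: phi_inv_unique.
by rewrite -mulrA phi_invE mulrA vV -mulrA phi_invE mulrA -rmorphM.
Qed.

Lemma phi_inv_avg v : inV v -> v = avg F i1 (i1 (phi_inv v) * e1).
Proof. by move=> vV; rewrite -phi_invE avgMl // (step_avg st1) mulr1. Qed.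

(** Writing v = avg(u e_1), the product e_1 v is sum E(x_i u) e_1 y_i, and the
    symmetric Markov condition allows to replace E(x_i u) by E(u x_i). *)
Lemma phi_invEl v : inV v -> e1 * v = e1 * i1 (phi_inv v).
Proof.
move=> vV; rewrite {1}(phi_inv_avg vV) /avg mulr_sumr.
under eq_bigr => p _.
  rewrite !mulrA -[e1 * _ * _]mulrA -rmorphM (step_cut st1) -symE; last exact: phi_inv_U.
  rewrite -(step_comm st1) -mulrA -rmorphM.
  over.
by rewrite -mulr_sumr -rmorph_sum (dualP F).1.
Qed.

Lemma phi_inv_surj u : inU u -> exists2 v, inV v & phi_inv v = u.
Proof.
move=> uU; exists (avg F i1 (i1 u * e1)).
  move=> m; apply/esym/avg_comm => n.
  exact: (inAM (inA_i1 uU) inA_e1).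
apply: phi_inv_unique; rewrite /avg mulr_suml.
under eq_bigr => p _.
  rewrite -!mulrA [e1 * (_ * _)]mulrA (step_cut st1) [i1 u * (_ * _)]mulrA -rmorphM uU.
  rewrite mulrA -rmorphM mulrA -[p.2]mulr1.
  over.
by rewrite -mulr_suml -rmorph_sum -mulr_suml (dualP F).2 mul1r.
Qed.

(** T_1 and T_0 correspond under phi; this is where the symmetric product
    condition is used. *)
Lemma t1_phi_inv v : inV v -> t1 v = t0 (phi_inv v).
Proof.
move=> vV; rewrite {1}(phi_inv_avg vV) /avg !linear_sum /=.
rewrite -[RHS]flip_dual; last exact: phi_inv_U.
rewrite mulr_suml !linear_sum mulr_sumr.
apply: eq_bigr => p _ /=.
rewrite mulrA -rmorphM (step_frob st1) !linearZ /=; congr (_ * _).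
by rewrite trT0 mulrA.
Qed.

(* w' is the inverse of the weight w, the families f1, f2 are the two legs of the
   separability element of V, and a, a' are the dual bases of E_M in A. *)
Variables (w w' : R1).
Hypotheses (wV : inV w) (w'V : inV w') (ww' : w * w' = 1) (w'w : w' * w = 1).
Variables (IV : Type) (sV : seq IV) (f1 f2 : IV -> R1).
Hypotheses (f1V : forall s, inV (f1 s)) (f2V : forall s, inV (f2 s)).
Hypothesis f_sum : \sum_(s <- sV) f1 s * f2 s = 1.
Hypothesis f_dual : forall v, inV v -> \sum_(s <- sV) t1 (f2 s * v) *: (f1 s * w) = v.
Variables (IA : Type) (sA : seq IA) (a a' : IA -> R1).
Hypothesis aA : forall s, inA (a s).
Hypothesis a_dual1 : forall x, \sum_(s <- sA) i1 (E1 (x * a s)) * a' s = x.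
Hypothesis a_dual2 : forall x, \sum_(s <- sA) a s * i1 (E1 (a' s * x)) = x.

(** Dual bases of A for T_1 = T_0 o E_M, obtained by composing dual bases of E_M
    with dual bases of U for T_0.  The latter are the images in U of the dual
    bases f1 w, f2 of V for T_1. *)
Definition dual_p s t := a s * i1 (phi_inv (f2 t)).
Definition dual_q s t := i1 (phi_inv (f1 t * w)) * a' s.

Lemma dual_p_A s t : inA (dual_p s t).
Proof. exact: inAM (aA s) (inA_i1 (phi_inv_U (f2V t))). Qed.

Lemma dualA x : inA x ->
  \sum_(s <- sA) \sum_(t <- sV) t1 (dual_p s t * x) *: dual_q s t = x.
Proof.
move=> xA; rewrite -[RHS]a_dual1; apply: eq_bigr => s _.
have /phi_inv_surj[v vV def_v] := E1_A (inAM xA (aA s)).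
under eq_bigr => t _.
  rewrite trT1 /dual_p mulrA frob_r -def_v -phi_inv_anti // -t1_phi_inv; last exact: inVM.
  rewrite /dual_q scalerAl -!linearZ /=.
  over.
by rewrite -mulr_suml -!linear_sum /= f_dual // def_v.
Qed.

(** Here E_M(q x) = r E_M(a' x) with r in U, so the three middle factors multiply to
    the image in U of f1 w w^-1 f2, and sum f1 f2 = 1.  This is what the weight w
    is made for. *)
Lemma dual_twist x :
  \sum_(s <- sA) \sum_(t <- sV) dual_p s t * i1 (phi_inv w') * i1 (E1 (dual_q s t * x)) = x.
Proof.
rewrite -[RHS]a_dual2; apply: eq_bigr => s _.
under eq_bigr => t _.
  rewrite /dual_q -mulrA -mulrA frob_l /dual_p -!mulrA -!rmorphM !mulrA -phi_inv_anti //.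
  rewrite -phi_inv_anti; [|exact: inVM|exact: inVM].
  rewrite -[_ * w * _]mulrA [w * (_ * _)]mulrA ww' mul1r rmorphM mulrA.
  over.
by rewrite -mulr_suml -mulr_sumr -!linear_sum /= f_sum phi_inv1 rmorph1 mulr1.
Qed.

Lemma t1_nondeg x y : inA x -> inA y ->
  (forall z, inA z -> t1 (z * x) = t1 (z * y)) -> x = y.
Proof.
move=> xA yA xy; rewrite -(dualA xA) -(dualA yA).
by apply: eq_bigr => s _; apply: eq_bigr => t _; rewrite xy //; apply: dual_p_A.
Qed.

(** * Representing the two pairings of A and B *)

Lemma push2l y : e2 * j (E2 (e2 * y)) = la *: (e2 * y).
Proof.
by rewrite [in RHS](push_left st2) lamG linearZ /= -scalerAr scalerA mulfV ?scale1r.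
Qed.

Lemma push2r y : j (E2 (y * e2)) * e2 = la *: (y * e2).
Proof.
by rewrite [in RHS](push_right st2) lamG linearZ /= -scalerAl scalerA mulfV ?scale1r.
Qed.

Lemma e2e1e2 : e2 * j e1 * e2 = la *: e2.
Proof. by rewrite (step_cut st2) (frob1_e st1) !linearZ /= !rmorph1 -scalerAl mul1r. Qed.

Lemma E2_e2 : E2 e2 = la *: 1.
Proof. by rewrite (frob1_e st2) lamG. Qed.

Lemma e2C m : e2 * j (i1 m) = j (i1 m) * e2.
Proof. exact: step_comm st2 m. Qed.

Lemma e1C n : e1 * i1 (i n) = i1 (i n) * e1.
Proof. exact: step_comm st1 n. Qed.

Lemma jAC x : inA x -> forall n, j x * j (i1 (i n)) = j (i1 (i n)) * j x.
Proof. by move=> xA n; rewrite -!rmorphM xA. Qed.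

Local Notation avg2 := (avg F (j \o i1)).

Lemma avg2_j x : avg2 (j x) = j (avg F i1 x).
Proof. by rewrite /avg rmorph_sum; apply: eq_bigr => p _; rewrite !rmorphM. Qed.

Lemma avg2_e1 : avg2 (j e1) = 1.
Proof. by rewrite avg2_j (step_avg st1) rmorph1. Qed.

Lemma avg2_B x : (forall n, x * j (i1 (i n)) = j (i1 (i n)) * x) -> inB (avg2 x).
Proof. by move=> xN m; apply/esym/(@avg_comm _ _ _ F _ (j \o i1)). Qed.

(** The element of A that represents the functional lam^2 <-, b> through T_1. *)
Definition riesz b := E2 (e2 * j e1 * j w * b).
Definition riesz_inv x := la ^- 2 *: (j w' * avg2 (j e1 * e2 * j x)).

Fact riesz_inv_lin : linear riesz_inv.
Proof.
move=> c x y; rewrite /riesz_inv linearP /= mulrDr -scalerAr linearP /=.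
by rewrite mulrDr -scalerAr scalerDr !scalerA mulrC.
Qed.
HB.instance Definition _ := GRing.isLinear.Build k R1 R2 *:%R riesz_inv riesz_inv_lin.

Lemma riesz_A b : inB b -> inA (riesz b).
Proof.
move=> bB n; rewrite /riesz -[LHS]frob_r -[RHS]frob_l; congr (E2 _).
rewrite -!mulrA bB [j w * (_ * _)]mulrA -rmorphM wV rmorphM -!mulrA.
by rewrite ![j e1 * (_ * _)]mulrA -[in LHS]rmorphM e1C rmorphM !mulrA e2C.
Qed.

Lemma e1e2_comm x : inA x -> forall n,
  j e1 * e2 * j x * j (i1 (i n)) = j (i1 (i n)) * (j e1 * e2 * j x).
Proof.
move=> xA n; rewrite -mulrA -rmorphM xA rmorphM !mulrA -[_ * e2 * _]mulrA e2C.
by rewrite mulrA -!rmorphM e1C.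
Qed.

Lemma riesz_inv_B x : inA x -> inB (riesz_inv x).
Proof.
move=> xA m; rewrite /riesz_inv -scalerAl -scalerAr; congr (_ *: _).
by apply: inBM => //; [exact: inB_j|apply: avg2_B; exact: e1e2_comm].
Qed.

(** Multiplying by e_1 on the left turns e_2 riesz(b) = lam e_2 e_1 w b into
    lam^2 e_1 w b; averaging removes e_1, since w b commutes with M. *)
Lemma rieszK b : inB b -> riesz_inv (riesz b) = b.
Proof.
move=> bB; have wbB := inBM (inB_j wV) bB.
rewrite /riesz_inv -mulrA /riesz -!mulrA push2l -scalerAr linearZ /=.
rewrite [e2 * _]mulrA [j e1 * _]mulrA [j e1 * (_ * _)]mulrA e1e2e1 -scalerAl linearZ /=.
rewrite (avgM F (h := j \o i1)) // avg2_e1 mul1r -!scalerAr !scalerA.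
rewrite [j w' * _]mulrA -rmorphM w'w rmorph1 mul1r.
by rewrite -expr2 mulVf ?scale1r ?expf_neq0.
Qed.

Lemma e1_cut m z : j e1 * (j (i1 m) * (j e1 * z)) = j e1 * (j (i1 (i (E m))) * z).
Proof. by rewrite !mulrA -!rmorphM (step_cut st1) e1C. Qed.

Lemma e2_cut z : e2 * (j e1 * (e2 * z)) = la *: (e2 * z).
Proof. by rewrite !mulrA e2e1e2 -scalerAl. Qed.

Lemma riesz_invK x : inA x -> riesz (riesz_inv x) = x.
Proof.
move=> xA; rewrite /riesz /riesz_inv -scalerAr linearZ /=.
rewrite mulrA -[_ * j w * _]mulrA -rmorphM ww' rmorph1 mulr1.
rewrite /avg mulr_sumr.
under eq_bigr => p _.
  rewrite /= -!mulrA e1_cut [j (i1 _) * (e2 * _)]mulrA -e2C -!mulrA.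
  rewrite e2_cut [j (i1 _) * (j x * _)]mulrA -rmorphM -xA.
  rewrite rmorphM -!mulrA -[j (i1 _) * j (i1 _)]rmorphM -[i1 _ * i1 _]rmorphM.
  over.
rewrite -scaler_sumr -!mulr_sumr -!rmorph_sum.
under eq_bigr => p _ do rewrite -[p.1]mul1r.
rewrite (dualP F).1 !rmorph1 mulr1 linearZ /= frob_r E2_e2 -scalerAl mul1r !scalerA.
by rewrite -mulrA -expr2 mulVf ?scale1r ?expf_neq0.
Qed.

(** The element of A that represents the second pairing. *)
Definition riesz' b := E2 (b * j e1 * e2) * w.
Definition riesz'_inv x := la ^- 2 *: avg2 (j (x * w') * e2 * j e1).

Lemma riesz'_A b : inB b -> inA (riesz' b).
Proof.
move=> bB; apply: inAM; last exact: inV_A.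
move=> n; rewrite -[LHS]frob_r -[RHS]frob_l; congr (E2 _).
by rewrite -mulrA e2C !mulrA -bB -!mulrA; congr (_ * _); rewrite !mulrA -!rmorphM e1C.
Qed.

Lemma riesz'K b : inB b -> riesz'_inv (riesz' b) = b.
Proof.
move=> bB; rewrite /riesz'_inv /riesz' -[_ * w * w']mulrA ww' mulr1 push2r -scalerAl.
rewrite [avg2 _]linearZ /=.
rewrite -!mulrA [j e1 * (_ * _)]mulrA e1e2e1 -scalerAr [avg2 _]linearZ /=.
rewrite (avgMl F (h := j \o i1)) // avg2_e1 mulr1 !scalerA.
by rewrite -expr2 mulVf ?scale1r ?expf_neq0.
Qed.

Lemma t2_riesz x b : t2 (j x * e2 * j e1 * j w * b) = t1 (x * riesz b).
Proof. by rewrite /riesz -!mulrA frob_l !mulrA. Qed.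

Lemma t2_riesz' x b : t2 (b * j e1 * e2 * j w * j x) = t1 (x * riesz' b).
Proof. by rewrite frob_r frob_r trT1. Qed.

(** * The action of B on M_1 and the comultiplication *)

Definition act b y := la^-1 *: E2 (b * j y * e2).
Definition pairing x b := la ^- 2 * t2 (j x * e2 * j e1 * j w * b).

Lemma act_V b v : inB b -> inV v -> inV (act b v).
Proof.
move=> bB vV m; rewrite /act -scalerAl -scalerAr; congr (_ *: _).
by apply: E2_B; apply: inBM inB_e2; apply: inBM => //; exact: inB_j.
Qed.

Lemma act_bimod b m y m' : inB b -> act b (i1 m * y * i1 m') = i1 m * act b y * i1 m'.
Proof.
move=> bB; rewrite /act -scalerAr -scalerAl; congr (_ *: _).
rewrite -frob_l -frob_r; congr (E2 _).
by rewrite !rmorphM -!mulrA -e2C !mulrA bB.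
Qed.

Lemma act_j v y : act (j v) y = v * y.
Proof.
by rewrite /act -rmorphM frob_l E2_e2 -scalerAr mulr1 scalerA mulVf ?scale1r.
Qed.

(** The central factor e_2 (a y_i e_1) e_2 reduces to E_M(a y_i e_1) e_2. *)
Lemma act_riesz_inv x :
  act (riesz_inv x) e1 = la ^- 2 *:
    (w' * \sum_(p <- dual F) i1 p.1 * e1 * i1 (E1 (x * i1 p.2 * e1))).
Proof.
rewrite /act; have -> : riesz_inv x * j e1 * e2 = la ^- 2 *: (j w' * \sum_(p <- dual F)
    j (i1 p.1 * e1 * i1 (E1 (x * i1 p.2 * e1))) * e2).
  rewrite /riesz_inv -!scalerAl -!mulrA; congr (_ *: (_ * _)).
  rewrite /avg mulr_suml; apply: eq_bigr => p _ /=.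
  by rewrite [in RHS]rmorphM -[RHS]mulrA -(step_cut st2) !rmorphM !mulrA.
rewrite -mulr_suml -rmorph_sum mulrA -rmorphM linearZ /= frob_l E2_e2.
by rewrite -scalerAr mulr1 !scalerA mulrC mulrA mulfV // mul1r.
Qed.

(** The two idempotents e_1 meet across m w^-1 x_i, giving coefficients E(u m x_i) in
    N with u the image of w^-1 in U; these commute with e_1, e_2 and z, so that the
    dual bases resum to u m. *)
Lemma e1_avg m z : inA z -> j e1 * j (i1 m) * j w' * avg2 (j e1 * e2 * j z)
  = j e1 * e2 * j z * j (i1 (phi_inv w' * m)).
Proof.
move=> zA.
have -> : j e1 * j (i1 m) * j w' = j e1 * j (i1 (phi_inv w' * m)).
  by rewrite -!rmorphM -mulrA -w'V mulrA phi_invEl // -mulrA -rmorphM.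
rewrite /avg mulr_sumr.
under eq_bigr => p _.
  rewrite /= -!mulrA [j (i1 _) * (j (i1 _) * _)]mulrA.
  rewrite -[j (i1 _) * j (i1 _)]rmorphM -[i1 _ * i1 _]rmorphM e1_cut.
  rewrite [j (i1 _) * (e2 * _)]mulrA -e2C -!mulrA [j (i1 _) * (j z * _)]mulrA -jAC //.
  rewrite -!mulrA -[j (i1 _) * j (i1 _)]rmorphM -[i1 _ * i1 _]rmorphM.
  over.
rewrite -!mulr_sumr -!rmorph_sum.
under eq_bigr => p _ do rewrite [phi_inv w' * _]mulrA.
by rewrite (dualP F).1 !mulrA.
Qed.

(* The families b1, b2 stand for the legs of a representative of the coproduct
   of b. *)
Section Comultiplication.
Variables (D : Type) (sD : seq D) (b1 b2 : D -> R2) (b : R2).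
Hypotheses (bB : inB b) (b1B : forall s, inB (b1 s)) (b2B : forall s, inB (b2 s)).
Hypothesis comult : forall x y, inA x -> inA y ->
  \sum_(s <- sD) pairing x (b1 s) * pairing y (b2 s) = pairing (x * y) b.

Lemma pairingE x c : pairing x c = la ^- 2 * t1 (x * riesz c).
Proof. by rewrite /pairing t2_riesz. Qed.

Lemma inB_sum I (s : seq I) (c : I -> k) (g : I -> R2) :
  (forall d, inB (g d)) -> inB (\sum_(d <- s) c d *: g d).
Proof.
move=> gB m; rewrite mulr_suml mulr_sumr; apply: eq_bigr => d _.
by rewrite -scalerAl gB scalerAr.
Qed.

Lemma riesz_lin : linear riesz.
Proof. by move=> c x y; rewrite /riesz mulrDr -scalerAr linearP. Qed.
HB.instance Definition _ := GRing.isLinear.Build k R2 R1 *:%R riesz riesz_lin.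

(** Pairing the left-hand side with z in A gives <x z, b>, which is
    lam^-2 T_1(z riesz(b) x); non-degeneracy of T_1 on A does the rest. *)
Lemma comult_left x : inA x ->
  \sum_(s <- sD) pairing x (b1 s) *: b2 s = riesz_inv (riesz b * x).
Proof.
move=> xA; have sB := inB_sum sD (fun s => pairing x (b1 s)) b2B.
rewrite -[LHS]rieszK //; congr (riesz_inv _).
apply: t1_nondeg => [||z zA]; [exact: riesz_A|exact: inAM (riesz_A bB) xA|].
have := comult xA zA; rewrite pairingE.
under eq_bigr => s _ do rewrite (pairingE z) mulrCA.
rewrite -mulr_sumr mulrA [in X in _ -> _ = X]trT1 mulrA => /mulfI <-; last first.
  by rewrite invr_neq0 ?expf_neq0.
rewrite linear_sum mulr_sumr 3!linear_sum; apply: eq_bigr => s _.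
by rewrite linearZ -scalerAr !linearZ.
Qed.

Lemma b1_expand s : b1 s =
  \sum_(c <- sA) \sum_(d <- sV)
    (la ^+ 2 * pairing (dual_p c d) (b1 s)) *: riesz_inv (dual_q c d).
Proof.
rewrite -[LHS]rieszK // -[in LHS](dualA (riesz_A (b1B s))) linear_sum.
apply: eq_bigr => c _; rewrite linear_sum; apply: eq_bigr => d _.
by rewrite linearZ pairingE mulrA mulfV ?expf_neq0 // mul1r.
Qed.

Lemma act_linl y : linear (act^~ y).
Proof.
by move=> c x z; rewrite /act !mulrDl -!scalerAl linearP scalerDr !scalerA mulrC.
Qed.

Lemma actZ y c x : act (c *: x) y = c *: act x y.
Proof. by rewrite /act -!scalerAl linearZ /= !scalerA mulrC. Qed.

Lemma jZl c x y : j (c *: x) * y = c *: (j x * y).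
Proof. by rewrite linearZ -scalerAl. Qed.

Lemma act_linr x : linear (act x).
Proof.
move=> c y z; rewrite /act linearP mulrDr mulrDl -scalerAr -scalerAl linearP.
by rewrite scalerDr !scalerA mulrC.
Qed.

(** The heart of the proof: the smash product rule for y = e_1. *)
Lemma smash_relation_e1 : \sum_(s <- sD) j (act (b1 s) e1) * b2 s = b * j e1.
Proof.
(* Expand b1 in the dual bases of A and absorb the coefficients into b2. *)
have -> : \sum_(s <- sD) j (act (b1 s) e1) * b2 s =
  \sum_(c <- sA) \sum_(d <- sV)
    la ^+ 2 *: (j (act (riesz_inv (dual_q c d)) e1) * riesz_inv (riesz b * dual_p c d)).
  transitivity (\sum_(s <- sD) \sum_(c <- sA) \sum_(d <- sV)
      (la ^+ 2 * pairing (dual_p c d) (b1 s)) *: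
        (j (act (riesz_inv (dual_q c d)) e1) * b2 s)).
    apply: eq_bigr => s _; rewrite {1}[b1 s]b1_expand (lin_sum _ _ (act_linl e1)).
    rewrite rmorph_sum mulr_suml; apply: eq_bigr => c _.
    rewrite (lin_sum _ _ (act_linl e1)) rmorph_sum mulr_suml; apply: eq_bigr => d _.
    by rewrite actZ jZl.
  rewrite exchange_big; apply: eq_bigr => c _.
  rewrite exchange_big; apply: eq_bigr => d _.
  rewrite -comult_left; last exact: dual_p_A.
  rewrite mulr_sumr scaler_sumr; apply: eq_bigr => s _.
  by rewrite -scalerAr scalerA.
(* Only the innermost sum depends on the dual bases of A; it has the form treated in
   dual_twist, with x = y_i e_1. *)
transitivity (la ^- 2 *: (j w' * \sum_(p <- dual F) j (i1 p.1) *
  (j e1 * e2 * j (riesz b)) * j (\sum_(c <- sA) \sum_(d <- sV)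
     dual_p c d * i1 (phi_inv w') * i1 (E1 (dual_q c d * (i1 p.2 * e1)))))).
  rewrite mulr_sumr scaler_sumr.
  under [RHS]eq_bigr => p _.
    rewrite rmorph_sum !mulr_sumr scaler_sumr.
    under eq_bigr do rewrite rmorph_sum !mulr_sumr scaler_sumr.
    over.
  rewrite [RHS]exchange_big; apply: eq_bigr => c _.
  rewrite [RHS]exchange_big; apply: eq_bigr => d _.
  rewrite act_riesz_inv jZl scalerA mulfV ?expf_neq0 // scale1r.
  move: (dual_p c d) (dual_p_A c d) (dual_q c d) => P PA Q.
  rewrite rmorphM rmorph_sum mulr_sumr mulr_suml; apply: eq_bigr => p _.
  rewrite /riesz_inv -!scalerAr; congr (_ *: _).
  have := e1_avg (E1 (Q * i1 p.2 * e1)) (inAM (riesz_A bB) PA).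
  by rewrite !rmorphM -!mulrA => ->.
under eq_bigr => p _ do rewrite dual_twist rmorphM mulrA.
by rewrite -mulr_suml [j w' * _]mulrA scalerAl -[in RHS](rieszK bB).
Qed.

(** Both sides are M-bilinear in y, because b, b1 and b2 commute with M, and
    M_1 = M e_1 M. *)
Lemma smash_relation y : \sum_(s <- sD) j (act (b1 s) y) * b2 s = b * j y.
Proof.
move: y; apply: (step_ind st1) => [|y z IHy IHz|m m'].
- rewrite linear0 mulr0 big1 // => s _.
  by rewrite /act linear0 mulr0 mul0r linear0 scaler0 linear0 mul0r.
- rewrite linearD mulrDr -IHy -IHz -big_split; apply: eq_bigr => s _.
  have := act_linr (b1 s) 1 y z; rewrite !scale1r => ->.
  by rewrite linearD mulrDl.
under eq_bigr => s _.
  rewrite act_bimod // !rmorphM -!mulrA -b2B !mulrA -!mulrA.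
  over.
rewrite -mulr_sumr.
under eq_bigr => s _ do rewrite mulrA.
by rewrite -mulr_suml smash_relation_e1 !rmorphM !mulrA bB.
Qed.

(** Cyclicity of the trace brings h next to e_2, where h e_2 = (h |> 1) e_2. *)
Lemma pairing_act c h : pairing 1 (c * h) = pairing (act h 1) c.
Proof.
rewrite /pairing; congr (_ * _); rewrite /act rmorph1 !mulr1 mul1r.
rewrite mulrA trT2 !mulrA; congr (T (E (E1 (E2 (_ * _ * _ * _))))).
by rewrite [LHS](push_right st2) lamG.
Qed.

Lemma rieszMr c v : riesz (c * j v) = riesz c * v.
Proof. by rewrite /riesz mulrA frob_r. Qed.

(** For b = 1 the left-hand side is eps_t(h), and the right-hand side is in V. *)
Lemma counit_act h : b = 1 -> inB h ->
  \sum_(s <- sD) pairing 1 (b1 s * h) *: b2 s = j (act h 1).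
Proof.
move=> def_b hB; have aV : inV (act h 1) by apply: act_V => // m; rewrite mul1r mulr1.
under eq_bigr => s _ do rewrite pairing_act.
rewrite comult_left; last exact: inV_A.
by rewrite -rieszMr def_b mul1r rieszK //; exact: inB_j.
Qed.

End Comultiplication.

(** The condition on y says S(y) = v.  Since riesz'(v) = lam v e_1 w, the formula for
    riesz_inv(a) |> e_1 evaluates y |> e_1 to e_1 v, the symmetric
    Markov condition entering through e_1 v = e_1 u and v e_1 = u e_1. *)
Lemma act_antipode y v : inB y -> inV v -> riesz y = riesz' (j v) ->
  forall x, act y x = x * v.
Proof.
move=> yB vV yv.
have act_e1 : act y e1 = e1 * v.
  rewrite -(rieszK yB) yv act_riesz_inv.
  have -> : riesz' (j v) = la *: (v * e1 * w).
    by rewrite /riesz' -rmorphM (frob1_eM st2) lamG -scalerAl.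
  under eq_bigr => p _.
    have -> : la *: (v * e1 * w) * i1 p.2 * e1 =
        la *: (i1 (i (E (p.2 * phi_inv w)) * phi_inv v) * e1).
      rewrite -!scalerAl; congr (_ *: _).
      rewrite -!mulrA [w * _]mulrA wV -mulrA phi_invE [i1 _ * (_ * _)]mulrA -rmorphM mulrA.
      rewrite -[LHS]mulrA [e1 * _]mulrA (step_cut st1) [LHS]mulrA vV -[LHS]mulrA (phi_invE v).
      by rewrite [i1 (_ * _)]rmorphM mulrA.
    rewrite linearZ /= (frob1_eM st1) scalerA [i1 (_ *: _)]linearZ -scalerAr.
    rewrite rmorphM mulrA -[_ * e1 * _]mulrA e1C !mulrA -rmorphM.
    over.
  rewrite -scaler_sumr -!mulr_suml -rmorph_sum (dualP F).2 -scalerAr scalerA.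
  rewrite -expr2 mulVf ?expf_neq0 // scale1r -phi_invE !mulrA w'w mul1r.
  exact/esym/phi_invEl.
apply: (step_ind st1) => [|x z IHx IHz|m m'].
- by rewrite /act linear0 mulr0 mul0r linear0 scaler0 mul0r.
- have := act_linr y 1 x z; rewrite !scale1r => ->.
  by rewrite IHx IHz mulrDl.
by rewrite act_bimod // act_e1 -!mulrA vV.
Qed.

(** * The smash product *)

Section Assembly.
Local Notation Asub := (centralizer (image_of (i1 \o i))).
Local Notation Bsub := (centralizer (image_of (j \o i1))).
Variables (IB : Type) (sB : seq IB) (u v : IB -> Bsub).
Hypothesis uv_dual : forall y, \sum_(s <- sB) j (E2 (y * val (u s))) * val (v s) = y.
Variables (Delta : Bsub -> ktens Bsub Bsub) (S : Bsub -> Bsub).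
Hypothesis Delta_pairing : forall (x y : Asub) (b : Bsub),
  tlift (fun c d => pairing (val x) (val c) * pairing (val y) (val d)) (Delta b)
  = pairing (val (x * y)) (val b).
Hypothesis S_pairing : forall (x : Asub) (b : Bsub),
  pairing (val x) (val b) = la ^- 2 * t2 (val (S b) * j e1 * e2 * j w * j (val x)).

(* The counit and the action are given up to pointwise equality, so that the
   isomorphism applies to any other presentation of the same maps. *)
Variables (eps : Bsub -> k) (actB : Bsub -> R1 -> R1).
Hypothesis epsE : forall b, eps b = pairing 1 (val b).
Hypothesis actBE : forall b x, actB b x = act (val b) x.
Local Notation MB := (smash Delta eps actB).
Local Notation sp := (spure Delta eps actB).

Lemma val_B (b : Bsub) : inB (val b).
Proof. by move=> m; apply: (centrP _ _ (valP b)); exists m. Qed.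

Lemma sub_B x : inB x -> {b : Bsub | val b = x}.
Proof.
move=> xB; have xin : x \in centr (image_of (j \o i1)).
  by apply/centrP => _ [m <-]; apply: xB.
by exists (exist _ x xin).
Qed.

Lemma sub_A x : inA x -> {b : Asub | val b = x}.
Proof.
move=> xB; have xin : x \in centr (image_of (i1 \o i)).
  by apply/centrP => _ [m <-]; apply: xB.
by exists (exist _ x xin).
Qed.

Lemma Delta_list b x y : inA x -> inA y ->
  \sum_(p <- reps (Delta b)) pairing x (val p.1) * pairing y (val p.2)
  = pairing (x * y) (val b).
Proof. by move=> /sub_A[x' <-] /sub_A[y' <-]; have := Delta_pairing x' y' b. Qed.

Lemma riesz_antipode b : riesz (val b) = riesz' (val (S b)).
Proof.
apply: t1_nondeg => [||x /sub_A[x' <-]]; [|exact: riesz'_A (val_B (S b))|].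
  exact: riesz_A (val_B b).
have := S_pairing x' b; rewrite pairingE t2_riesz' => /mulfI -> //.
by rewrite invr_neq0 ?expf_neq0.
Qed.

Lemma antipode_bij : bijective S.
Proof.
pose g (b : Bsub) := sval (sub_B (riesz_inv_B (riesz'_A (val_B b)))).
have gE b : val (g b) = riesz_inv (riesz' (val b)) by rewrite /g; case: sub_B.
exists g => b; apply: val_inj.
  by rewrite gE -riesz_antipode (rieszK (val_B b)).
rewrite -(riesz'K (val_B (S (g b)))) -riesz_antipode gE riesz_invK.
  exact: riesz'K (val_B b).
exact: riesz'_A (val_B b).
Qed.

(** The target counital map is h |-> h |> 1, which together with act_j identifies
    the target counital subalgebra with V. *)
Lemma eps_tE h : val (eps_t Delta eps h) = j (act (val h) 1).
Proof.
have B1 : inB 1 by move=> m; rewrite mul1r mulr1.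
have := counit_act B1 (fun p : Bsub * Bsub => val_B p.2)
  (fun x y (xA : inA x) (yA : inA y) => Delta_list 1 xA yA) erefl (val_B h).
by move=> <-; rewrite /eps_t /tlift rmorph_sum; apply: eq_bigr => p _; rewrite epsE.
Qed.

Lemma V1 : inV 1.
Proof. by move=> m; rewrite mul1r mulr1. Qed.

Lemma targetE (z : target Delta eps) :
  inV (actB (sval z) 1) /\ val (sval z) = j (actB (sval z) 1).
Proof.
split; first by rewrite actBE; apply: act_V V1; apply: val_B.
by have [h zh] := svalP z; rewrite actBE zh !eps_tE act_j mulr1.
Qed.

Lemma target_V x : inV x -> exists z : target Delta eps, val (sval z) = j x.
Proof.
move=> xV; have [b bx] := sub_B (inB_j xV).
exists (exist _ (eps_t Delta eps b) (ex_intro _ b erefl)).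
by rewrite /= eps_tE bx act_j mulr1.
Qed.

Definition psi : MB -> R2 := tlift (fun x b => j x * val b).

Lemma sp_bal x (z : target Delta eps) h : sp (x * actB (sval z) 1) h = sp x (sval z * h).
Proof. exact: pure_bal. Qed.

Lemma psi_bal : balanced (fun x (z : target Delta eps) => x * actB (sval z) 1)
  (fun (z : target Delta eps) h => sval z * h) (fun x (b : Bsub) => j x * val b).
Proof.
split=> [x x' y|x y y'|c x y|c x y|x z y].
- by rewrite rmorphD mulrDl.
- by rewrite rmorphD mulrDr.
- exact: jZl.
- by rewrite linearZ -scalerAr.
- have -> : val (sval z * y) = val (sval z) * val y by [].
  by rewrite (targetE z).2 rmorphM mulrA.
Qed.

Lemma psi_lin : linear psi.
Proof. exact: (tlift_lin psi_bal). Qed.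

Lemma psi_pure x b : psi (sp x b) = j x * val b.
Proof. exact: (tlift_pure psi_bal). Qed.

Definition psi_inv (y : R2) : MB := \sum_(s <- sB) sp (E2 (y * val (u s))) (v s).

Lemma psi_inv_lin : linear psi_inv.
Proof.
move=> c x y; rewrite /psi_inv scaler_sumr -big_split; apply: eq_bigr => s _ /=.
by rewrite mulrDl -scalerAl linearP /spure pureDl pureZl.
Qed.

Lemma psi_invK : cancel psi_inv psi.
Proof.
move=> y; rewrite -[RHS]uv_dual /psi_inv (lin_sum _ _ psi_lin).
by apply: eq_bigr => s _; rewrite psi_pure.
Qed.

(** E_{M_1}(x b u_j) = x E_{M_1}(b u_j) with E_{M_1}(b u_j) in V = B_t, which moves
    across the tensor sign and recombines with v_j to b. *)
Lemma psiK : cancel psi psi_inv.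
Proof.
apply: linear_ext => [||x b].
- exact: lin_comp psi_inv_lin psi_lin.
- by [].
rewrite -/(sp x b) psi_pure /psi_inv.
have bu s : inV (E2 (val b * val (u s))) := E2_B (inBM (val_B b) (val_B (u s))).
pose c s : Bsub := sval (sub_B (inB_j (bu s))).
have cE s : val (c s) = j (E2 (val b * val (u s))) by rewrite /c; case: sub_B.
transitivity (\sum_(s <- sB) sp x (c s * v s)).
  apply: eq_bigr => s _; have [z zE] := target_V (bu s).
  have -> : c s = sval z by apply: val_inj; rewrite cE.
  rewrite -sp_bal; congr (sp _ _).
  by rewrite -mulrA frob_l actBE zE act_j mulr1.
rewrite /spure -pure_sumr; congr (pure x _); apply: val_inj.
rewrite rmorph_sum -[RHS]uv_dual; apply: eq_bigr => s _.
by rewrite -cE.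
Qed.

(** The product is the one of M_2 transported along psi, so that each axiom is checked
    after applying psi. *)
Theorem smash_iso : exists mul : MB -> MB -> MB,
  is_smash_product S mul /\
  exists f : {linear MB -> R2},
    [/\ forall x b, f (sp x b) = j x * val b,
        bijective f,
        forall s t, f (mul s t) = f s * f t
      & f (sp 1 1) = 1].
Proof.
exists (fun s t => psi_inv (psi s * psi t)); split; last first.
  pose L := GRing.isLinear.Build k MB R2 *:%R psi psi_lin.
  pose f : {linear MB -> R2} := HB.pack psi L.
  exists f; split=> [x b||s t|]; rewrite /f /=.
  - exact: psi_pure.
  - exact: Bijective psiK psi_invK.
  - by rewrite psi_invK.
  - by rewrite psi_pure rmorph1 mul1r.
split.
- exact: antipode_bij.
- move=> y z x Syz; rewrite actBE; apply: act_antipode (val_B y) (targetE z).1 _ x.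
  by rewrite riesz_antipode Syz -(targetE z).2.
- move=> t c x y; rewrite psi_lin mulrDl -scalerAl.
  exact: psi_inv_lin.
- move=> t c x y; rewrite psi_lin mulrDr -scalerAr.
  exact: psi_inv_lin.
- move=> x h y g; apply: (can_inj psiK); rewrite psi_invK !psi_pure.
  rewrite /tlift (lin_sum _ _ psi_lin) !mulrA -[j x * _ * j y]mulrA.
  rewrite -(smash_relation (val_B h) (fun p : Bsub * Bsub => val_B p.1)
    (fun p => val_B p.2) (fun a b (aA : inA a) (bA : inA b) => Delta_list h aA bA)).
  rewrite mulr_sumr mulr_suml; apply: eq_bigr => p _; rewrite psi_pure.
  have -> : val (p.2 * g) = val p.2 * val g by [].
  by rewrite actBE rmorphM !mulrA.
- by move=> s t r; rewrite !psi_invK mulrA.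
- by move=> t; rewrite psi_pure rmorph1 !mul1r psiK.
- by move=> t; rewrite psi_pure rmorph1 mul1r mulr1 psiK.
Qed.

End Assembly.

End Tower.

(** * The separability element and the concrete tower *)

Section Casimir.
Variables (k : fieldType) (R : algType k) (t : R -> k) (f : ktens R R).
Hypotheses (tD : {morph t : x y / x + y}) (tZ : forall c x, t (c *: x) = c * t x).

Let t_bal : balanced (fun (x : R) (c : k) => c *: x) (fun (c : k) (y : R) => c *: y)
  (fun x y => t y *: x).
Proof.
split=> [x x' y|x y y'|c x y|c x y|x c y].
- by rewrite scalerDr.
- by rewrite tD scalerDl.
- by rewrite !scalerA mulrC.
- by rewrite tZ scalerA.
- by rewrite tZ scalerA mulrC.
Qed.

(** The Casimir property of f with a linear form applied to the second leg. *)
Lemma sym_sep_dual v : sym_sep_elt f ->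
  \sum_(p <- reps f) t (p.2 * v) *: p.1 = v * tlift (fun x y => t y *: x) f.
Proof.
case=> _ /(_ v) + _ => /(congr1 (tlift (fun x y => t y *: x))).
rewrite /(tlift (fun x y => pure _ _)) => /esym.
rewrite !(lin_sum _ _ (tlift_lin t_bal)).
under eq_bigr do rewrite (tlift_pure t_bal).
under [RHS]eq_bigr do rewrite (tlift_pure t_bal).
by move=> ->; rewrite mulr_sumr; apply: eq_bigr => p _; rewrite scalerAr.
Qed.
End Casimir.

Lemma valV k N M (F : @ssext k N M) (v : V F) : inV (F1 F) (val v).
Proof. by move=> m; apply: (centrP _ _ (valP v)); exists m. Qed.

Lemma valA k N M (F : @ssext k N M) (a : A F) : inA F (F1 F) (val a).
Proof. by move=> n; apply: (centrP _ _ (valP a)); exists n. Qed.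

(** Shows that the two alternatives of the symmetric product condition both yield
    lam T_0(sum y_i x_i u) = T_0(u) on U. *)
Lemma phi_trace k N M (F : @ssext k N M) (T : {scalar N}) (u : U F) :
  (forall x y, T (frob F (x * y)) = T (frob F (y * x))) ->
  T1 T (phi u) = lam F * T (frob F ((\sum_(p <- dual F) p.2 * p.1) * val u)).
Proof.
move=> trT0; rewrite /T1 /T0.
have -> : frob (F1 F) (phi u) = lam F *: \sum_(p <- dual F) p.1 * val u * p.2.
  rewrite /phi linear_sum scaler_sumr; apply: eq_bigr => p _.
  exact: bfrob_pure.
rewrite !linearZ mulr_suml; congr (_ * _); rewrite !linear_sum.
by apply: eq_bigr => p _; rewrite /= trT0 mulrA.
Qed.

Theorem theorem4p3 (k : fieldType) (N M : algType k) (F : ssext N M)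
    (T : {scalar N}) :
  sym_markov F T ->
  symmetric_product F \/ (forall u : U F, T0 F T (val u) = T1 T (phi u)) ->
  weakly_irreducible F T ->
  depth2 F ->
  forall (f : ktens (V F) (V F)) (w : V F)
         (Delta : B F -> ktens (B F) (B F)) (S : B F -> B F),
  sym_sep_elt f ->
  w * sep_trace T f = 1 -> sep_trace T f * w = 1 ->
  is_comult T w Delta ->
  is_antipode T w S ->
  let MB := smash Delta (counit T w) (@action k N M F) in
  exists mul : MB -> MB -> MB,
    is_smash_product S mul /\
    exists psi : {linear MB -> M2 F},
      [/\ forall x b, psi (spure Delta (counit T w) (@action k N M F) x b)
                        = j x * val b,
          bijective psi,
          forall s t, psi (mul s t) = psi s * psi t
        & psi (spure Delta (counit T w) (@action k N M F) 1 1) = 1].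
Proof.
move=> [[trT _ trT0] symE] sym_prod _ [[sA [dA1 dA2]] [sB [dB _]]] f w Delta S.
move=> sep_f ww' w'w Delta_form S_form.
have subU u : inU F u -> {u' : U F | val u' = u}.
  move=> uU; have uin : u \in centr (image_of (inc F)).
    by apply/centrP => _ [n <-]; apply: uU.
  by exists (exist _ u uin).
have subV v : inV (F1 F) v -> {v' : V F | val v' = v}.
  move=> vV; have vin : v \in centr (image_of (inc (F1 F))).
    by apply/centrP => _ [n <-]; apply: vV.
  by exists (exist _ v vin).
have T2j x : T2 T (j x) = T1 T x by rewrite /T2 frobK.
have valw (x y : V F) : x * y = 1 -> val x * val y = 1 :> basic F.
  by move=> xy; rewrite -[RHS](congr1 val xy).
refine (@smash_iso k N M _ _ F (F1 F) (F2 F) (e1 F) (e2 F) T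
  (basic_jones_step F) (basic_jones_step (F1 F)) erefl (temperley_lieb1 F)
  trT trT0 _ _ (val w) (val (sep_trace T f)) (valV w) (valV _) (valw _ _ ww') (valw _ _ w'w)
  _ (reps f) (fun p => val p.1) (fun p => val p.2) (fun p => valV p.1) (fun p => valV p.2)
  _ _ _ sA (fun p => val p.1) (fun p => val p.2) (fun p => valA p.1) _ _
  _ sB (fun p => p.1) (fun p => p.2) _ Delta S _ _ (counit T w) (@action k N M F) _ _).
- by move=> u x /subU[u' <-]; apply: symE; exact: valP.
- move=> u /subU[u' <-]; case: sym_prod => [->|TU]; last first.
    by rewrite -[RHS]/(T0 F T (val u')) TU phi_trace.
  by rewrite -scalerAl mul1r !linearZ /= mulrA mulfV ?mul1r ?lam_neq0.
- have [f1 _ _] := sep_f; rewrite -[RHS]/(val (1 : V F)) -f1 /tlift rmorph_sum.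
  by apply: eq_bigr => p _.
- move=> v /subV[v' <-].
  have sepE : sep_trace T f = tlift (fun x y => T1 T (val y) *: x) f.
    by apply: eq_bigr => p _; rewrite T2j.
  have t1D : {morph (fun x : V F => T1 T (val x)) : x y / x + y}.
    by move=> x y; rewrite /T1 /T0 !linearD.
  have t1Z (c : k) (x : V F) : T1 T (val (c *: x)) = c * T1 T (val x).
    by rewrite /T1 /T0 !linearZ.
  have := sym_sep_dual t1D t1Z v' sep_f; rewrite -sepE => /(congr1 ( *%R^~ w)).
  rewrite -mulrA w'w mulr1 => /(congr1 val) def_v; rewrite -[RHS]def_v.
  rewrite mulr_suml rmorph_sum; apply: eq_bigr => p _.
  by rewrite -scalerAl.
- by move=> x; have := dA1 x; rewrite big_map.
- by move=> x; have := dA2 x; rewrite big_map.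
- by move=> x; have := dB x; rewrite big_map.
- by move=> x y b; have := Delta_form x y b.
- by move=> x b; have := S_form x b.
- by [].
- by [].
Qed.
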